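(* Let $\varkappa>0$ and consider the one-dimensional system, in the variables $\mathbf{v}=(\rho,u,\eta,j)$ with $\rho>0$, $$\partial_t\rho+u\,\partial_x\rho+\rho\,\partial_xu=0,\qquad \partial_tu+u\,\partial_xu+\frac1\rho\frac{\partial p}{\partial\rho}\partial_x\rho+\frac1\rho\frac{\partial p}{\partial\eta}\partial_x\eta=0,$$ $$\partial_t\eta+u\,\partial_x\eta+\frac{\varkappa^2}{\rho^2}\partial_xj-\frac{\varkappa^2}{\rho^3}j\,\partial_x\rho=0,\qquad \partial_tj+j\,\partial_xu+u\,\partial_xj+\frac{\partial\theta}{\partial\rho}\partial_x\rho+\frac{\partial\theta}{\partial\eta}\partial_x\eta=0,$$ for the polytropic gas with $\gamma=2$, $c_V=1$, i.e. $\varepsilon(\rho,\eta)=\rho e^{\eta}$, $p=\rho^2e^\eta$, $\theta=\rho e^\eta$. Let $\lambda_1<\lambda_2<\lambda_3<\lambda_4$ be its characteristic speeds and $\mathbf{r}_1,\dots,\mathbf{r}_4$ corresponding right eigenvectors. Then $\nabla_{\mathbf{v}}\lambda_4\cdot\mathbf{r}_4\neq0$ for all states, while $\nabla_{\mathbf{v}}\lambda_3\cdot\mathbf{r}_3$ vanishes exactly on the set $$\varkappa\,v=\frac{\sqrt6}{\sqrt{2+\sqrt[3]{17-12\sqrt2}+\sqrt[3]{17+12\sqrt2}}}=1.0399\ldots,\qquad v=1/\rho,$$ which separates two regions in which $\nabla_{\mathbf{v}}\lambda_3\cdot\mathbf{r}_3$ (with $\mathbf{r}_3$ normalized to have $\rho$-component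 equal to $\rho$) has different signs. In particular the fourth characteristic field is genuinely nonlinear in the sense of Lax, and the third is neither genuinely nonlinear nor linearly degenerate.
   Context: The characteristic speeds are the eigenvalues of the quasilinear matrix of the system: $\lambda_{1,4}=u\mp\sqrt{Y_1+Y_2}$, $\lambda_{2,3}=u\mp\sqrt{Y_1-Y_2}$, with $Y_1=\frac12(a_p^2+a_T^2)$, $Y_2=\sqrt{a_{pT}^4+\frac14(a_p^2-a_T^2)^2}$, $a_p^2=\frac{\partial p}{\partial\rho}$, $a_T^2=\frac{\varkappa^2}{\rho^2}\frac{\partial\theta}{\partial\eta}$, $a_{pT}^4=\frac{\varkappa^2}{\rho^2}\frac{\partial p}{\partial\eta}\frac{\partial\theta}{\partial\rho}$. A characteristic field $(\lambda_i,\mathbf{r}_i)$ is genuinely nonlinear if $\nabla_{\mathbf{v}}\lambda_i\cdot\mathbf{r}_i\ne0$ at every state and linearly degenerate if $\nabla_{\mathbf{v}}\lambda_i\cdot\mathbf{r}_i=0$ at every state. *)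

(* Defs.v *)
From HB Require Import structures.
From mathcomp Require Import all_boot all_order all_algebra.
From mathcomp Require Import all_classical all_reals all_analysis.
From mathcomp Require Import ring.

Set Implicit Arguments.
Unset Strict Implicit.
Unset Printing Implicit Defensive.

Import Order.TTheory GRing.Theory Num.Theory.
Import numFieldNormedType.Exports.

Local Open Scope ring_scope.

(* [ok] is the k-th of four indices (with underlying value k - 1). It serves
   both for the components (rho, u, eta, j) of a state and for numbering the
   characteristic fields. *)
Definition o1 : 'I_4 := @Ordinal 4 0 isT.
Definition o2 : 'I_4 := @Ordinal 4 1 isT.
Definition o3 : 'I_4 := @Ordinal 4 2 isT.
Definition o4 : 'I_4 := @Ordinal 4 3 isT.

Section System.
Variable R : realType.

Definition rho (v : 'cV[R]_4) : R := v o1 ord0.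
Definition vel (v : 'cV[R]_4) : R := v o2 ord0.
Definition eta (v : 'cV[R]_4) : R := v o3 ord0.
Definition flux (v : 'cV[R]_4) : R := v o4 ord0.

Definition is_state (v : 'cV[R]_4) : Prop := 0 < rho v.

(* Partial derivatives of a function of (rho, eta), taken at a state. *)
Definition d_rho (f : R -> R -> R) (v : 'cV[R]_4) : R :=
  derive1 (fun x => f x (eta v)) (rho v).
Definition d_eta (f : R -> R -> R) (v : 'cV[R]_4) : R :=
  derive1 (fun y => f (rho v) y) (eta v).

Variables (kappa : R) (p theta : R -> R -> R).

(* The four equations at a point (t, x), where v is the value of the unknown
   and vt, vx are those of its t- and x-derivatives. *)
Definition system_eqs (v vt vx : 'cV[R]_4) : Prop :=
  [/\ rho vt + vel v * rho vx + rho v * vel vx = 0,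
      vel vt + vel v * vel vx + (rho v)^-1 * d_rho p v * rho vx
        + (rho v)^-1 * d_eta p v * eta vx = 0,
      eta vt + vel v * eta vx + kappa ^+ 2 / rho v ^+ 2 * flux vx
        - kappa ^+ 2 / rho v ^+ 3 * flux v * rho vx = 0 &
      flux vt + flux v * vel vx + vel v * flux vx
        + d_rho theta v * rho vx + d_eta theta v * eta vx = 0].

Definition quasilinear_matrix (v : 'cV[R]_4) : 'M[R]_4 :=
  \matrix_(i < 4, j < 4) nth 0 (nth [::]
    [:: [:: vel v; rho v; 0; 0];
        [:: (rho v)^-1 * d_rho p v; vel v; (rho v)^-1 * d_eta p v; 0];
        [:: - (kappa ^+ 2 / rho v ^+ 3 * flux v); 0; vel v;
            kappa ^+ 2 / rho v ^+ 2];
        [:: d_rho theta v; flux v; d_eta theta v; vel v]] i) j.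

Lemma system_eqsE (v vt vx : 'cV[R]_4) :
  system_eqs v vt vx <-> vt + quasilinear_matrix v *m vx = 0.
Proof.
have sum4 (F : 'I_4 -> R) : \sum_i F i = F o1 + (F o2 + (F o3 + F o4)).
  rewrite !big_ord_recl big_ord0 addr0.
  by do 3?[congr (_ + _)]; congr F; apply: val_inj.
have row_eq (i : 'I_4) : (vt + quasilinear_matrix v *m vx) i ord0 =
    vt i ord0 + (quasilinear_matrix v i o1 * rho vx
    + (quasilinear_matrix v i o2 * vel vx
    + (quasilinear_matrix v i o3 * eta vx
    + quasilinear_matrix v i o4 * flux vx))).
  by rewrite [LHS]mxE [X in _ + X]mxE sum4.
split=> [[e1 e2 e3 e4]|e].
- apply/matrixP => i j; rewrite (ord1 j) row_eq [RHS]mxE !mxE.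
  case: i => [[|[|[|[|//]]]] lti] /=.
  + rewrite (_ : vt _ _ = rho vt); last by congr (vt _ _); apply: val_inj.
    by rewrite -[RHS]e1; ring.
  + rewrite (_ : vt _ _ = vel vt); last by congr (vt _ _); apply: val_inj.
    by rewrite -[RHS]e2; ring.
  + rewrite (_ : vt _ _ = eta vt); last by congr (vt _ _); apply: val_inj.
    by rewrite -[RHS]e3; ring.
  + rewrite (_ : vt _ _ = flux vt); last by congr (vt _ _); apply: val_inj.
    by rewrite -[RHS]e4; ring.
- have row0 i : (vt + quasilinear_matrix v *m vx) i ord0 = 0.
    by rewrite e mxE.
  split.
  + by rewrite -[RHS](row0 o1) row_eq !mxE /= /rho; ring.
  + by rewrite -[RHS](row0 o2) row_eq !mxE /= /vel; ring.
  + by rewrite -[RHS](row0 o3) row_eq !mxE /= /eta; ring.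
  + by rewrite -[RHS](row0 o4) row_eq !mxE /= /flux; ring.
Qed.

Definition ap2 (v : 'cV[R]_4) : R := d_rho p v.
Definition aT2 (v : 'cV[R]_4) : R := kappa ^+ 2 / rho v ^+ 2 * d_eta theta v.
Definition apT4 (v : 'cV[R]_4) : R :=
  kappa ^+ 2 / rho v ^+ 2 * d_eta p v * d_rho theta v.
Definition Y1 (v : 'cV[R]_4) : R := 2^-1 * (ap2 v + aT2 v).
Definition Y2 (v : 'cV[R]_4) : R :=
  Num.sqrt (apT4 v + 4^-1 * (ap2 v - aT2 v) ^+ 2).

Definition speed_formula (i : 'I_4) (v : 'cV[R]_4) : R :=
  nth 0 [:: vel v - Num.sqrt (Y1 v + Y2 v);
            vel v - Num.sqrt (Y1 v - Y2 v);
            vel v + Num.sqrt (Y1 v - Y2 v);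
            vel v + Num.sqrt (Y1 v + Y2 v)] i.

End System.

Section Fields.
Variable R : realType.
Implicit Types (A : 'cV[R]_4 -> 'M[R]_4) (lam : 'I_4 -> 'cV[R]_4 -> R).

(* [eigenvalue] is phrased with row (left) eigenvectors; the spectrum is the
   same for right eigenvectors. *)
Definition characteristic_speeds A lam : Prop :=
  forall v, is_state v ->
    (forall i j : 'I_4, (i < j)%N -> lam i v < lam j v) /\
    (forall a : R, eigenvalue (A v) a <-> exists i : 'I_4, a = lam i v).

Definition right_eigenvectors A lam (r : 'I_4 -> 'cV[R]_4 -> 'cV[R]_4) : Prop :=
  forall v, is_state v -> forall i : 'I_4,
    r i v != 0 /\ A v *m r i v = lam i v *: r i v.

Definition grad (f : 'cV[R]_4 -> R) (v : 'cV[R]_4) : 'rV[R]_4 :=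
  \row_(k < 4) 'D_(delta_mx k ord0) f v.

Definition grad_dot (f : 'cV[R]_4 -> R) (r : 'cV[R]_4 -> 'cV[R]_4)
    (v : 'cV[R]_4) : R :=
  (grad f v *m r v) ord0 ord0.

Definition genuinely_nonlinear (f : 'cV[R]_4 -> R)
    (r : 'cV[R]_4 -> 'cV[R]_4) : Prop :=
  forall v, is_state v -> grad_dot f r v != 0.

Definition linearly_degenerate (f : 'cV[R]_4 -> R)
    (r : 'cV[R]_4 -> 'cV[R]_4) : Prop :=
  forall v, is_state v -> grad_dot f r v = 0.

End Fields.

Section Polytropic.
Variable R : realType.

Definition gas_energy (x y : R) : R := x * expR y.
Definition gas_p (x y : R) : R := x ^+ 2 * expR y.
Definition gas_theta (x y : R) : R := x * expR y.

Lemma gas_pE (v : 'cV[R]_4) :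
  gas_p (rho v) (eta v) = rho v ^+ 2 * d_rho gas_energy v.
Proof.
rewrite /gas_p /d_rho /gas_energy derive1E deriveM // derive_cst derive_id.
by rewrite scaler0 add0r [_ *: _]mulr1.
Qed.

Lemma gas_thetaE (v : 'cV[R]_4) :
  gas_theta (rho v) (eta v) = d_eta gas_energy v.
Proof.
rewrite /gas_theta /d_eta /gas_energy derive1E deriveM // derive_cst derive_val.
by rewrite scaler0 addr0.
Qed.

(* The cube root only for x >= 0; [powR] is 1 at negative bases. Both arguments
   17 -+ 12 sqrt 2 = (3 -+ 2 sqrt 2)^2 below are positive. *)
Definition cbrt (x : R) : R := x `^ 3^-1.

Definition critical_value : R :=
  Num.sqrt 6 / Num.sqrt (2 + cbrt (17 - 12 * Num.sqrt 2)
                           + cbrt (17 + 12 * Num.sqrt 2)).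

End Polytropic.

(* Main.v *)
Require Import Defs.
From HB Require Import structures.
From mathcomp Require Import all_boot all_order all_algebra.
From mathcomp Require Import all_classical all_reals all_analysis.
From mathcomp Require Import ring lra.

Set Implicit Arguments.
Unset Strict Implicit.
Unset Printing Implicit Defensive.

Import Order.TTheory GRing.Theory Num.Theory.
Import numFieldNormedType.Exports.

Local Open Scope ring_scope.

(** Write T = rho e^eta for the temperature and m = (kappa / rho)^2. For this
    gas Y1 = T (1 + m/2) and Y2 = T sqrt (1 + (m/2)^2), so each characteristic
    speed is u plus or minus mu with mu^2 = T (1 + w), where w is one of the two
    roots of w^2 = m w + 1: the root w > 1 belongs to the outer fields 1 and 4,
    the root -1 < w < 0 to the inner fields 2 and 3. An eigenvector for u + mu
    is determined by its rho-component; scaled to have that component equal to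
    rho it is (rho, mu, w - 1, ...), and the speed has no j-derivative. Since
    m = w - 1/w, every quantity can be expressed in w, and along this
    eigenvector the gradient of u + mu comes out as

      mu (w^3 + 3 w + 2) / (2 (w^2 + 1))

    ([grad_dot_forward]). On the fourth field w > 1, so this is positive.

    On the third field w < 0, and the increasing cubic w^3 + 3 w + 2 has a
    single root z there, which Cardano gives as the difference of the cube roots
    of sqrt 2 - 1 and sqrt 2 + 1. As m = w - 1/w is increasing in w < 0, the
    sign of the cubic is the sign of m - (z - 1/z), and the critical value c of
    kappa / rho satisfies c^2 = z - 1/z ([nonlinearity_cubic_sign]). Hence the
    gradient along the eigenvector has the sign of kappa / rho - c
    ([slow_field_sign]), which is the claim; evaluating the cubic at two
    rationals near z gives the digits of c.

    An arbitrary increasing family of characteristic speeds coincides with the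
    explicit one at every state ([characteristic_speeds_unique]), hence near
    every state, because the states form an open set; so it has the same
    derivatives. *)

(* HB.structures exports another constant of this name. *)
Local Notation eta := Defs.eta.

(** * Increasing enumerations *)

(** One inequality of the inductive step in [increasing_enum_unique]: g i is
    some f k, and k < i would give g k = f k = g i, contradicting that g is
    strictly increasing. *)
Lemma increasing_enum_le d (T : orderType d) n (f g : 'I_n -> T) :
  (forall i j : 'I_n, (i < j)%N -> (f i < f j)%O) ->
  (forall i j : 'I_n, (i < j)%N -> (g i < g j)%O) ->
  (forall i, exists k, g i = f k) ->
  forall i : 'I_n, (forall j : 'I_n, (j < i)%N -> f j = g j) -> (f i <= g i)%O.
Proof.
move=> fi gi gf i eq_lt; have [k gk] := gf i.
rewrite gk; case: (ltngtP k i) => [ki|ik|/val_inj -> //].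
  by have := gi _ _ ki; rewrite gk (eq_lt _ ki) ltxx.
exact/ltW/fi.
Qed.

Lemma increasing_enum_unique d (T : orderType d) n (f g : 'I_n -> T) :
  (forall i j : 'I_n, (i < j)%N -> (f i < f j)%O) ->
  (forall i j : 'I_n, (i < j)%N -> (g i < g j)%O) ->
  (forall a, (exists i, a = f i) <-> (exists i, a = g i)) ->
  f =1 g.
Proof.
move=> fi gi fg.
have gf i : exists k, g i = f k by apply/fg; exists i.
have fg' i : exists k, f i = g k by apply/fg; exists i.
have H (k : nat) (i : 'I_n) : (i < k)%N -> f i = g i.
  elim: k i => [//|k IH] i; rewrite ltnS => ik.
  have eq_lt (j : 'I_n) : (j < i)%N -> f j = g j.
    by move=> ji; apply: IH; exact: leq_trans ji ik.
  apply/eqP; rewrite eq_le.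
  rewrite (increasing_enum_le fi gi gf eq_lt) /=.
  by apply: (increasing_enum_le gi fi fg') => j /eq_lt.
by move=> i; exact: (H _ _ (ltn_ord i)).
Qed.

(** * Differentials of real-valued functions *)

Section Calculus.
Variables (R : realType) (V : normedModType R).
Implicit Types (f g df dg : V -> R) (v : V).

(** Differentiability is local. This is what transfers the derivatives of the
    explicit speeds to functions that agree with them at states only. *)
Lemma is_diff_near_eq f g dg v :
  (\forall w \near v, f w = g w) -> is_diff v g dg -> is_diff v f dg.
Proof.
move=> fg [gdiff gE].
have fgv : f v = g v by exact: nbhs_singleton fg.
have fE : f \o shift v = cst (f v) + 'd g v +o_ 0 id.
  apply/eqaddoP => e e0.
  have := (eqaddoP _ _ _ _).1 (diff_locally gdiff) _ e0.
  have fg0 : \forall h \near (0 : V), f (h + v) = g (h + v).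
    move: fg; rewrite (near_shift 0 v) /=.
    by apply: filterS => h; rewrite subr0.
  apply: filterS2 fg0 => h /= fgh.
  by rewrite /GRing.opp /= /GRing.add /= fgh fgv.
have E : 'd f v = 'd g v :> (V -> R).
  by apply: diff_unique fE; exact: diff_continuous.
split; last by rewrite E.
by apply/diff_locallyP; split; rewrite E //; exact: diff_continuous.
Qed.

(** The rules below are stated on pointwise expressions, with differentials in
    the form of explicit functions of the direction h, so that they chain by
    unification and leave scalar identities. *)
Lemma is_diff_prod f df g dg v : is_diff v f df -> is_diff v g dg ->
  is_diff v (fun w => f w * g w) (fun h => f v * dg h + g v * df h).
Proof. by move=> hf hg; exact: (is_diffM hf hg). Qed.

Lemma is_diff_sum f df g dg v : is_diff v f df -> is_diff v g dg ->
  is_diff v (fun w => f w + g w) (fun h => df h + dg h).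
Proof. by move=> hf hg; exact: (is_diffD hf hg). Qed.

Lemma is_diff_diff f df g dg v : is_diff v f df -> is_diff v g dg ->
  is_diff v (fun w => f w - g w) (fun h => df h - dg h).
Proof. by move=> hf hg; exact: (is_diffB hf hg). Qed.

Lemma is_diff_chain (F : R -> R) F' f df v : is_diff v f df ->
  is_derive (f v) 1 F F' -> is_diff v (fun w => F (f w)) (fun h => F' * df h).
Proof.
move=> hf [hF FE].
have dF : is_diff (f v) F (fun h => h * F').
  have D : differentiable F (f v) by exact/derivable1_diffP.
  by split=> //; rewrite (diff1E D) derive1E FE.
apply: is_diff_eq (is_diff_comp hf dF) _.
by apply/funext => h /=; rewrite mulrC.
Qed.

End Calculus.

Section Gradient.
Variable R : realType.

Lemma is_diff_coord m n (M : 'M[R]_(m, n)) i j :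
  is_diff M (fun N : 'M[R]_(m, n) => N i j) (fun N => N i j).
Proof.
split; first exact: differentiable_coord.
pose F := fun N : 'M[R]_(m, n) => N i j.
have lF : linear F by move=> a N N'; rewrite /F !mxE.
pose FM := GRing.isLinear.Build _ _ _ _ _ lF.
pose FL : {linear _ -> _} := HB.pack F FM.
by apply: (@diff_lin _ _ _ FL); exact: coord_continuous.
Qed.

Lemma grad_dotE (f df : 'cV[R]_4 -> R) (r : 'cV[R]_4 -> 'cV[R]_4) v :
  is_diff v f df -> grad_dot f r v = df (r v).
Proof.
move=> fd; have D : differentiable f v by exact: ex_diff.
rewrite /grad_dot mxE -(@diff_val _ _ _ _ _ _ _ fd).
rewrite [in RHS](matrix_sum_delta (r v)) linear_sum; apply: eq_bigr => i _.
rewrite big_ord1 linearZ /= mxE deriveE //.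
by rewrite mulrC.
Qed.

End Gradient.

(** * The two roots of w^2 = m w + 1 *)

Section Branch.
Variable R : realType.
Implicit Types s m w : R.

(** The sign s = 1 or s = -1 selects the root, so that the fast and the slow
    waves are treated by the same computations. *)
Definition branch s m := m / 2 + s * Num.sqrt (1 + (m / 2) ^+ 2).

Lemma branch_quadratic s m : s ^+ 2 = 1 ->
  branch s m ^+ 2 = m * branch s m + 1.
Proof.
move=> s1; have r2 : Num.sqrt (1 + (m / 2) ^+ 2) ^+ 2 = 1 + (m / 2) ^+ 2.
  by rewrite sqr_sqrtr // addr_ge0 // sqr_ge0.
by rewrite /branch sqrrD (exprMn _ s) s1 r2; field.
Qed.

Lemma quadratic_neq0 m w : w ^+ 2 = m * w + 1 -> w != 0.
Proof.
move=> wm; apply: contra_eq_neq wm => ->.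
by rewrite mulr0 add0r expr0n eq_sym oner_neq0.
Qed.

Lemma quadratic_solve m w : w ^+ 2 = m * w + 1 -> m = w - w^-1.
Proof.
move=> wm; have w0 := quadratic_neq0 wm.
by apply: (mulIf w0); rewrite mulrBl mulVf // -expr2 wm addrK.
Qed.

Lemma branch1_gt1 m : 0 < m -> 1 < branch 1 m.
Proof.
move=> m0; rewrite /branch mul1r.
have : 1 <= Num.sqrt (1 + (m / 2) ^+ 2).
  by rewrite -[leLHS]sqrtr1 ler_sqrt; rewrite ?lerDl ?addr_ge0 ?sqr_ge0.
lra.
Qed.

Lemma branchN1_gt m : 0 < m -> -1 < branch (-1) m.
Proof.
move=> m0; rewrite /branch mulN1r ltrBrDr -ltrBrDl opprK.
rewrite -[ltRHS]ger0_norm; last by lra.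
by rewrite -sqrtr_sqr ltr_sqrt; nra.
Qed.

Lemma branchN1_lt0 m : branch (-1) m < 0.
Proof.
rewrite /branch mulN1r subr_lt0.
apply: le_lt_trans (ler_norm _) _; rewrite -sqrtr_sqr ltr_sqrt; nra.
Qed.

(** Implicit differentiation of w^2 = m w + 1 gives w' = w / (2 w - m), and
    2 w - m = w + 1/w. *)
Lemma branch_derive s m : s ^+ 2 = 1 ->
  is_derive m 1 (branch s) (branch s m ^+ 2 / (branch s m ^+ 2 + 1)).
Proof.
move=> s1.
have q0 : 0 < 1 + (m / 2) ^+ 2 by rewrite ltr_wpDr ?sqr_ge0.
pose q (m : R) := 1 + (m / 2) ^+ 2.
have dh : is_derive m 1 (fun m : R => m / 2) (2^-1).
  apply: (is_derive_eq (is_deriveM _ _)).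
  by rewrite !scaler0 add0r [_ *: _]mulr1.
have dq : is_derive m 1 q (m / 2).
  have dq' : is_derive m 1 q _ :=
    is_deriveD (is_derive_cst (1 : R) m 1) (is_deriveX 2 dh).
  apply: (is_derive_eq dq').
  by rewrite add0r expr1 /GRing.scale /=; field.
have q1 : 0 < q m by [].
have dr := is_derive1_comp (is_derive1_sqrt q1) dq.
apply: (is_derive_eq (is_deriveD dh (is_deriveZ s dr))).
have := sqr_sqrtr (ltW q0).
have : 0 < Num.sqrt (1 + (m / 2) ^+ 2) by rewrite sqrtr_gt0.
rewrite /GRing.scale /= /branch; move: (Num.sqrt _) => r r0 r2.
have -> : 2^-1 + s * ((2 * r)^-1 * (m / 2)) = (r + s * (m / 2)) / (2 * r).
  by field; rewrite gt_eqF.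
have -> : (m / 2 + s * r) ^+ 2 + 1 = 2 * r * (r + s * (m / 2)).
  rewrite sqrrD (exprMn _ s) s1 mul1r; move: r2; lra.
(* s ^+ 2 = 1, so that m/2 + s r = s (r + s m/2) *)
have -> : (m / 2 + s * r) ^+ 2 = (r + s * (m / 2)) ^+ 2.
  rewrite !sqrrD !(exprMn _ s) s1; lra.
have : r + s * (m / 2) != 0.
  apply/eqP => e; move: r2; suff -> : r ^+ 2 = (m / 2) ^+ 2 by lra.
  have <- : (s * (m / 2)) ^+ 2 = (m / 2) ^+ 2 by rewrite (exprMn _ s) s1 mul1r.
  have -> : s * (m / 2) = - r by lra.
  by rewrite sqrrN.
by move: (r + _) => a a0; field; rewrite a0 gt_eqF.
Qed.

End Branch.

(** * The cubic and the critical value *)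

Section Critical.
Variable R : realType.
Implicit Types (w x : R).

(** The factor of the derivative of a forward speed along its eigenvector that
    can change sign; see [grad_dot_forward]. *)
Definition nonlinearity_cubic w := w ^+ 3 + 3 * w + 2.

Lemma cbrtK x : 0 <= x -> cbrt x ^+ 3 = x.
Proof.
by move=> x0; rewrite /cbrt -powR_mulrn ?powR_ge0 // -powRrM mulVf ?powRr1.
Qed.

Lemma cbrtX x n : 0 <= x -> cbrt (x ^+ n) = cbrt x ^+ n.
Proof.
by move=> x0; rewrite /cbrt -(powR_mulrn n x0) powRAC powR_mulrn ?powR_ge0.
Qed.

(** Cardano's formula for the real root of [nonlinearity_cubic]. *)
Definition nonlinearity_root : R :=
  cbrt (Num.sqrt 2 - 1) - cbrt (Num.sqrt 2 + 1).

(** With a, b the two cube roots, a b = 1 and a^3 - b^3 = -2, so that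
    (a - b)^3 = -2 - 3 (a - b). Moreover 17 -+ 12 sqrt 2 are the fourth powers
    of sqrt 2 -+ 1, so the radicand in the critical value is
    a^4 + b^4 + 2 = (a^2 + b^2)^2, and a^2 + b^2 = (a - b)^2 + 2. *)
Lemma nonlinearity_rootP :
  [/\ nonlinearity_cubic nonlinearity_root = 0, nonlinearity_root < 0 &
      critical_value R = Num.sqrt 6 / (nonlinearity_root ^+ 2 + 2)].
Proof.
have q2 : Num.sqrt 2 ^+ 2 = 2 :> R by rewrite sqr_sqrtr.
have q1 : 1 < Num.sqrt 2 :> R by rewrite -[ltLHS]sqrtr1 ltr_sqrt //; lra.
have p4 : (Num.sqrt 2 + 1) ^+ 4 = 17 + 12 * Num.sqrt 2 :> R.
  transitivity ((Num.sqrt 2 ^+ 2 + 2 * Num.sqrt 2 + 1) ^+ 2 : R); first by ring.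
  rewrite q2.
  transitivity (9 + 12 * Num.sqrt 2 + 4 * Num.sqrt 2 ^+ 2 : R); first by ring.
  by rewrite q2; ring.
have m4 : (Num.sqrt 2 - 1) ^+ 4 = 17 - 12 * Num.sqrt 2 :> R.
  transitivity ((Num.sqrt 2 ^+ 2 - 2 * Num.sqrt 2 + 1) ^+ 2 : R); first by ring.
  rewrite q2.
  transitivity (9 - 12 * Num.sqrt 2 + 4 * Num.sqrt 2 ^+ 2 : R); first by ring.
  by rewrite q2; ring.
have a3 := @cbrtK (Num.sqrt 2 - 1 : R) ltac:(lra).
have b3 := @cbrtK (Num.sqrt 2 + 1 : R) ltac:(lra).
have ab : cbrt (Num.sqrt 2 - 1) * cbrt (Num.sqrt 2 + 1) = 1 :> R.
  rewrite /cbrt -powRM; [|lra|lra].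
  by rewrite -subr_sqr q2 expr1n (_ : 2 - 1 = 1) ?powR1 //; ring.
have a0 : 0 < cbrt (Num.sqrt 2 - 1) :> R by rewrite powR_gt0 //; lra.
rewrite /nonlinearity_cubic /critical_value /nonlinearity_root.
rewrite -p4 -m4 !cbrtX; [|lra|lra].
move: (cbrt _) (cbrt _) a3 b3 ab a0 => b a a3 b3 ab a0.
have b0 : 0 < b by rewrite -(pmulr_rgt0 _ a0) ab.
split.
- transitivity (a ^+ 3 - b ^+ 3 + 2 - 3 * (a * b - 1) * (a - b)); first by ring.
  by rewrite a3 b3 ab; ring.
- rewrite subr_lt0 -(@ltr_pXn2r _ 3) ?nnegrE ?ltW // a3 b3; lra.
- congr (_ / _); rewrite (_ : 2 + _ + _ = ((a - b) ^+ 2 + 2) ^+ 2).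
    by rewrite sqrtr_sqr ger0_norm // addr_ge0 // sqr_ge0.
  transitivity (((a - b) ^+ 2 + 2 * (a * b)) ^+ 2
    + 2 * (1 - a * b) * (1 + a * b)); first by ring.
  by rewrite ab; ring.
Qed.

Lemma critical_value_gt0 : 0 < critical_value R.
Proof.
have [_ _ ->] := nonlinearity_rootP.
by rewrite divr_gt0 ?sqrtr_gt0 ?ltr_wpDl ?sqr_ge0.
Qed.

Lemma sqr_critical_value :
  critical_value R ^+ 2 = nonlinearity_root - nonlinearity_root^-1.
Proof.
have [q neg ->] := nonlinearity_rootP.
rewrite expr_div_n sqr_sqrtr //; move: nonlinearity_root q neg => w q neg.
have w0 : w != 0 by rewrite lt_eqF.
have p0 : w ^+ 2 + 2 != 0 by rewrite gt_eqF // ltr_wpDl ?sqr_ge0.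
apply/eqP; rewrite -subr_eq0; apply/eqP.
transitivity (- nonlinearity_cubic w * (w ^+ 3 - 2) / (w * (w ^+ 2 + 2) ^+ 2)).
  by rewrite /nonlinearity_cubic; field; rewrite w0 p0.
by rewrite q oppr0 !mul0r.
Qed.

(** Both w^3 + 3 w + 2 and w - 1/w are increasing for w < 0, and they are
    compared with their values at the common point [nonlinearity_root], which
    are 0 and the square of the critical value. *)
Lemma nonlinearity_cubic_sign w : w < 0 ->
  exists2 k, 0 < k &
    nonlinearity_cubic w = k * (w - w^-1 - critical_value R ^+ 2).
Proof.
move=> wneg; rewrite sqr_critical_value; have [q neg _] := nonlinearity_rootP.
move: nonlinearity_root q neg => z q neg.
have w0 : w != 0 by rewrite lt_eqF.
have z0 : z != 0 by rewrite lt_eqF.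
have wz : 0 < w * z by nra.
exists (w * z * (w ^+ 2 + w * z + z ^+ 2 + 3) / (w * z + 1)).
  apply: divr_gt0; last by lra.
  by apply: mulr_gt0 => //; have := sqr_ge0 w; have := sqr_ge0 z; lra.
rewrite -[LHS]subr0 -q /nonlinearity_cubic; field.
by rewrite w0 z0 gt_eqF // addr_gt0.
Qed.

(** The rationals -152/255 and -273/458 enclose [nonlinearity_root] so tightly
    that w - 1/w takes values above 1.0399^2 at the first and below 1.04^2 at
    the second. *)
Lemma critical_value_bounds :
  10399 / 10000 <= critical_value R /\ critical_value R < 10400 / 10000.
Proof.
have c0 := critical_value_gt0; have c0' := ltW c0.
(* smaller numerals keep the arithmetic below tractable *)
suff: 104 / 100 - 1 / (100 * 100) <= critical_value R /\
      critical_value R < 104 / 100.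
  by case=> lo hi; split; lra.
split.
- have [|k k0 kE] := @nonlinearity_cubic_sign (- (152 / 255)); first by lra.
  have : k * (- (152 / 255) - (- (152 / 255))^-1 - critical_value R ^+ 2) < 0.
    by rewrite -kE /nonlinearity_cubic; lra.
  rewrite pmulr_rlt0 // invrN invf_div => cE.
  by rewrite -ler_sqr ?nnegrE; lra.
- have [|k k0 kE] := @nonlinearity_cubic_sign (- (273 / 458)); first by lra.
  have : 0 < k * (- (273 / 458) - (- (273 / 458))^-1 - critical_value R ^+ 2).
    by rewrite -kE /nonlinearity_cubic; lra.
  rewrite pmulr_rgt0 // invrN invf_div => cE.
  by rewrite -ltr_sqr ?nnegrE; lra.
Qed.

End Critical.

(** * Characteristic speeds of the gas *)

Section Gas.
Variables (R : realType) (kappa : R).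
Hypothesis hkappa : 0 < kappa.
Implicit Types (v : 'cV[R]_4) (s : R).

Local Notation A := (quasilinear_matrix kappa (@gas_p R) (@gas_theta R)).
Local Notation speed := (speed_formula kappa (@gas_p R) (@gas_theta R)).

Definition temperature v := gas_theta (rho v) (eta v).
(** The square of kappa times the specific volume 1 / rho. *)
Definition kv2 v := (kappa / rho v) ^+ 2.
(** Speed of a wave relative to the gas: fast for s = 1, slow for s = -1. *)
Definition wave_speed s v := Num.sqrt (temperature v * (1 + branch s (kv2 v))).

Lemma d_rho_gas_p v : d_rho (@gas_p R) v = 2 * temperature v.
Proof.
rewrite /d_rho derive1E /gas_p; apply: derive_val.
apply: (is_derive_eq (is_deriveM (is_deriveX 2 (is_derive_id _ _)) _)).
rewrite scaler0 add0r /GRing.scale /= /temperature /gas_theta; ring.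
Qed.

Lemma d_eta_gas_p v : d_eta (@gas_p R) v = rho v * temperature v.
Proof.
rewrite /d_eta derive1E /gas_p; apply: derive_val.
apply: (is_derive_eq (is_deriveZ (rho v ^+ 2) (is_derive_expR _))).
rewrite /GRing.scale /= /temperature /gas_theta; ring.
Qed.

Lemma d_rho_gas_theta v : d_rho (@gas_theta R) v = expR (eta v).
Proof.
rewrite /d_rho derive1E /gas_theta; apply: derive_val.
apply: (is_derive_eq (is_deriveM (is_derive_id _ _) _)).
rewrite scaler0 add0r /GRing.scale /=; ring.
Qed.

Lemma d_eta_gas_theta v : d_eta (@gas_theta R) v = temperature v.
Proof.
by rewrite /d_eta derive1E /gas_theta; apply: derive_val.
Qed.

Lemma temperature_gt0 v : is_state v -> 0 < temperature v.
Proof. by move=> v0; rewrite mulr_gt0 ?expR_gt0. Qed.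

Lemma expR_eta v : is_state v -> expR (eta v) = temperature v / rho v.
Proof.
by move=> v0; rewrite /temperature /gas_theta mulrC mulKf // gt_eqF.
Qed.

Lemma kv2_gt0 v : is_state v -> 0 < kv2 v.
Proof. by move=> v0; rewrite exprn_gt0 // divr_gt0. Qed.

Lemma Y1_gas v : is_state v ->
  Y1 kappa (@gas_p R) (@gas_theta R) v = temperature v * (1 + kv2 v / 2).
Proof.
move=> v0; rewrite /Y1 /ap2 /aT2 d_rho_gas_p d_eta_gas_theta /kv2; field.
by rewrite gt_eqF.
Qed.

Lemma Y2_gas v : is_state v ->
  Y2 kappa (@gas_p R) (@gas_theta R) v =
  temperature v * Num.sqrt (1 + (kv2 v / 2) ^+ 2).
Proof.
move=> v0; rewrite -[X in X * _](gtr0_norm (temperature_gt0 v0)) -sqrtr_sqr.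
rewrite -sqrtrM ?sqr_ge0 // /Y2; congr Num.sqrt.
rewrite /apT4 /ap2 /aT2 d_rho_gas_p d_eta_gas_p d_rho_gas_theta d_eta_gas_theta.
rewrite /kv2 /temperature /gas_theta; field.
by rewrite gt_eqF.
Qed.

Lemma speed_formula_gas v : is_state v -> forall i,
  speed i v = nth 0 [:: vel v - wave_speed 1 v; vel v - wave_speed (-1) v;
                        vel v + wave_speed (-1) v; vel v + wave_speed 1 v] i.
Proof.
move=> v0 i; rewrite /speed_formula Y1_gas // Y2_gas //.
rewrite -mulrDr -mulrBr -!addrA.
by rewrite /wave_speed /branch mul1r mulN1r.
Qed.

Lemma branch_kv2_gt s v : is_state v -> s ^+ 2 = 1 -> 0 < 1 + branch s (kv2 v).
Proof.
move=> v0 /eqP; rewrite sqrf_eq1 => /orP[]/eqP->.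
  by have := branch1_gt1 (kv2_gt0 v0); lra.
by have := branchN1_gt (kv2_gt0 v0); lra.
Qed.

Lemma wave_speed_gt0 s v : is_state v -> s ^+ 2 = 1 -> 0 < wave_speed s v.
Proof.
by move=> v0 s1; rewrite sqrtr_gt0 mulr_gt0 ?temperature_gt0 // branch_kv2_gt.
Qed.

Lemma sqr_wave_speed s v : is_state v -> s ^+ 2 = 1 ->
  wave_speed s v ^+ 2 = temperature v * (1 + branch s (kv2 v)).
Proof.
move=> v0 s1; rewrite sqr_sqrtr // mulr_ge0 // ltW //.
  exact: temperature_gt0.
exact: branch_kv2_gt.
Qed.

Lemma wave_speed_lt v : is_state v -> wave_speed (-1) v < wave_speed 1 v.
Proof.
move=> v0; have m0 := kv2_gt0 v0; have t0 := temperature_gt0 v0.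
rewrite ltr_sqrt; last by rewrite mulr_gt0 ?branch_kv2_gt ?expr1n.
rewrite ltr_pM2l //; have := branchN1_lt0 (kv2 v); have := branch1_gt1 m0; lra.
Qed.

(** The characteristic polynomial of the quasilinear matrix at u + mu. *)
Definition characteristic_quartic v mu :=
  mu ^+ 4 - temperature v * (2 + kv2 v) * mu ^+ 2 + temperature v ^+ 2 * kv2 v.

Lemma characteristic_quarticE v mu : is_state v ->
  characteristic_quartic v mu =
  (mu - wave_speed 1 v) * (mu + wave_speed 1 v) *
  ((mu - wave_speed (-1) v) * (mu + wave_speed (-1) v)).
Proof.
move=> v0; rewrite -!subr_sqr !sqr_wave_speed ?expr1n ?sqrrN ?expr1n //.
have r2 : Num.sqrt (1 + (kv2 v / 2) ^+ 2) ^+ 2 = 1 + (kv2 v / 2) ^+ 2.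
  by rewrite sqr_sqrtr // addr_ge0 // sqr_ge0.
rewrite /branch /characteristic_quartic; move: (Num.sqrt _) r2 => r r2.
transitivity (mu ^+ 4 - temperature v * (2 + kv2 v) * mu ^+ 2
   + temperature v ^+ 2 * ((1 + kv2 v / 2) ^+ 2 - r ^+ 2)); last by field.
by rewrite r2; field.
Qed.

Definition state_of (a b c d : R) : 'cV[R]_4 :=
  \col_(i < 4) nth 0 [:: a; b; c; d] i.

Lemma ord4P (P : 'I_4 -> Prop) : P o1 -> P o2 -> P o3 -> P o4 -> forall i, P i.
Proof.
move=> P1 P2 P3 P4 [[|[|[|[|//]]]] lti].
- by rewrite (_ : Ordinal _ = o1) //; exact: val_inj.
- by rewrite (_ : Ordinal _ = o2) //; exact: val_inj.
- by rewrite (_ : Ordinal _ = o3) //; exact: val_inj.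
- by rewrite (_ : Ordinal _ = o4) //; exact: val_inj.
Qed.

Lemma big_ord4 (F : 'I_4 -> R) : \sum_i F i = F o1 + F o2 + F o3 + F o4.
Proof.
rewrite !big_ord_recl big_ord0 addr0 !addrA.
by do 3?[congr (_ + _)]; congr F; apply: val_inj.
Qed.

Lemma rho_state_of a b c d : rho (state_of a b c d) = a.
Proof. by rewrite /rho mxE. Qed.

Lemma vel_state_of a b c d : vel (state_of a b c d) = b.
Proof. by rewrite /vel mxE. Qed.

Lemma eta_state_of a b c d : eta (state_of a b c d) = c.
Proof. by rewrite /Defs.eta mxE. Qed.

Lemma flux_state_of a b c d : flux (state_of a b c d) = d.
Proof. by rewrite /flux mxE. Qed.

Lemma gas_matrix_mulmx v (r : 'cV[R]_4) : is_state v ->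
  A v *m r = state_of
    (vel v * rho r + rho v * vel r)
    (2 * expR (eta v) * rho r + vel v * vel r + temperature v * eta r)
    (vel v * eta r + kv2 v * (flux r - flux v / rho v * rho r))
    (expR (eta v) * rho r + flux v * vel r + temperature v * eta r
       + vel v * flux r).
Proof.
move=> v0; have x0 : rho v != 0 by rewrite gt_eqF.
apply/colP; apply: ord4P; rewrite !mxE big_ord4 !mxE /=
    ?(d_rho_gas_p, d_eta_gas_p, d_rho_gas_theta, d_eta_gas_theta)
    /kv2 /temperature /gas_theta /rho /vel /Defs.eta /flux;
  by field; rewrite ?x0.
Qed.

Lemma mulmx_gas_matrix v (l : 'rV[R]_4) : is_state v ->
  l *m A v = \row_(i < 4) nth 0
    [:: vel v * l ord0 o1 + 2 * expR (eta v) * l ord0 o2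
          - kv2 v * flux v / rho v * l ord0 o3 + expR (eta v) * l ord0 o4;
        rho v * l ord0 o1 + vel v * l ord0 o2 + flux v * l ord0 o4;
        temperature v * l ord0 o2 + vel v * l ord0 o3
          + temperature v * l ord0 o4;
        kv2 v * l ord0 o3 + vel v * l ord0 o4] i.
Proof.
move=> v0; have x0 : rho v != 0 by rewrite gt_eqF.
apply/rowP; apply: ord4P; rewrite !mxE big_ord4 !mxE /=
    ?(d_rho_gas_p, d_eta_gas_p, d_rho_gas_theta, d_eta_gas_theta)
    /kv2 /temperature /gas_theta;
  by field; rewrite ?x0.
Qed.

(** The columns 4, 3 and 2 of l A = a l express the first three components of a
    left eigenvector l through the last one, and column 1 then becomes the
    quartic times that component. This avoids expanding a determinant. *)
Lemma eigenvalue_quartic v a : is_state v ->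
  eigenvalue (A v) a <-> characteristic_quartic v (a - vel v) = 0.
Proof.
move=> v0; have x0 : rho v != 0 by rewrite gt_eqF.
have m0 : kv2 v != 0 by rewrite gt_eqF // kv2_gt0.
have t0 : temperature v != 0 by rewrite gt_eqF // temperature_gt0.
have e0 := expR_eta v0.
rewrite -{1}[a](subrK (vel v)) /characteristic_quartic; move: (a - vel v) => {a} mu.
split=> [/eigenvalueP[l]|q].
- rewrite mulmx_gas_matrix // => /rowP l_eig l0.
  have := l_eig o1; have := l_eig o2; have := l_eig o3; have := l_eig o4.
  have {l0} : ~ (l ord0 o1 = 0 /\ l ord0 o2 = 0 /\ l ord0 o3 = 0 /\ l ord0 o4 = 0).
    move=> [z1 [z2 [z3 z4]]]; move/eqP: l0; apply.
    by apply/rowP; apply: ord4P; rewrite !mxE.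
  rewrite !mxE /= {l_eig} e0.
  move: (l ord0 o1) (l ord0 o2) (l ord0 o3) (l ord0 o4) => l1 l2 l3 l4.
  move=> nz E4 E3 E2 E1.
  have F3 : l3 = mu * l4 / kv2 v.
    by apply: (mulIf m0); rewrite divfK //; lra.
  have F2 : l2 = mu * l3 / temperature v - l4.
    by apply: (mulIf t0); rewrite mulrBl divfK //; lra.
  have F1 : l1 = (mu * l2 - flux v * l4) / rho v.
    by apply: (mulIf x0); rewrite divfK //; lra.
  have l40 : l4 != 0.
    apply/eqP => z4; apply: nz.
    by rewrite F1 F2 F3 z4 !(mulr0, mul0r, subr0).
  have G : mu * l1 - (2 * (temperature v / rho v) * l2
      - kv2 v * flux v / rho v * l3 + temperature v / rho v * l4) = 0 by lra.
  apply: (mulIf l40); rewrite mul0r.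
  rewrite -(mulr0 (temperature v * kv2 v * rho v)) -[in RHS]G.
  by rewrite F1 F2 F3; field; rewrite x0 m0 t0.
- apply/eigenvalueP.
  pose l3 := mu / kv2 v; pose l2 := mu * l3 / temperature v - 1.
  pose l1 := (mu * l2 - flux v) / rho v.
  exists (\row_(i < 4) nth 0 [:: l1; l2; l3; 1] i); last first.
    by apply/eqP => /rowP/(_ o4)/eqP; rewrite !mxE /= oner_eq0.
  rewrite mulmx_gas_matrix // e0; apply/rowP; apply: ord4P; rewrite !mxE /=.
  + apply/eqP; rewrite -subr_eq0; apply/eqP.
    transitivity (- (mu ^+ 4 - temperature v * (2 + kv2 v) * mu ^+ 2
        + temperature v ^+ 2 * kv2 v) / (temperature v * kv2 v * rho v));
      last by rewrite q oppr0 mul0r.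
    by rewrite /l1 /l2 /l3; field; rewrite x0 m0 t0.
  + by rewrite /l1; field.
  + by rewrite /l2; field.
  + by rewrite /l3; field.
Qed.

(** The right eigenvector for u + mu whose rho-component is rho. *)
Definition gas_eigenvector v mu := state_of
  (rho v) mu (mu ^+ 2 / temperature v - 2)
  (flux v + mu * (mu ^+ 2 / temperature v - 2) / kv2 v).

Lemma gas_eigenvectorP v mu : is_state v -> characteristic_quartic v mu = 0 ->
  A v *m gas_eigenvector v mu = (vel v + mu) *: gas_eigenvector v mu.
Proof.
move=> v0 q; have x0 : rho v != 0 by rewrite gt_eqF.
have m0 : kv2 v != 0 by rewrite gt_eqF // kv2_gt0.
have t0 : temperature v != 0 by rewrite gt_eqF // temperature_gt0.
have e0 := expR_eta v0.
rewrite gas_matrix_mulmx // e0.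
rewrite rho_state_of vel_state_of eta_state_of flux_state_of.
apply/colP; apply: ord4P; rewrite !mxE /=.
- by ring.
- by field; rewrite x0 t0.
- by field; rewrite x0 m0 t0.
- apply/eqP; rewrite -subr_eq0; apply/eqP.
  transitivity (- characteristic_quartic v mu / (temperature v * kv2 v));
    last by rewrite q oppr0 mul0r.
  by rewrite /characteristic_quartic; field; rewrite x0 m0 t0.
Qed.

(** The first three equations of the eigenvector system determine the other
    components from the rho-component, so every eigenspace is at most a line. *)
Lemma gas_eigenvector_unique v mu (r : 'cV[R]_4) : is_state v ->
  A v *m r = (vel v + mu) *: r -> r = (rho r / rho v) *: gas_eigenvector v mu.
Proof.
move=> v0; have x0 : rho v != 0 by rewrite gt_eqF.
have m0 : kv2 v != 0 by rewrite gt_eqF // kv2_gt0.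
have t0 : temperature v != 0 by rewrite gt_eqF // temperature_gt0.
have e0 := expR_eta v0.
rewrite gas_matrix_mulmx // e0 => /colP rE.
have := rE o1; have := rE o2; have := rE o3; rewrite !mxE /= {rE}.
rewrite -[r o1 ord0]/(rho r) -[r o2 ord0]/(vel r) -[r o3 ord0]/(eta r).
move=> E3 E2 E1.
have F2 : vel r = rho r / rho v * mu.
  by apply: (mulIf x0); rewrite mulrAC divfK //; lra.
have F3 : eta r = rho r / rho v * (mu ^+ 2 / temperature v - 2).
  apply: (mulfI t0).
  transitivity (mu * vel r - 2 * (temperature v / rho v) * rho r); first by lra.
  by rewrite F2; field; rewrite x0 t0.
have F4 : flux r =
    rho r / rho v * (flux v + mu * (mu ^+ 2 / temperature v - 2) / kv2 v).
  apply: (mulfI m0).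
  transitivity (mu * eta r + kv2 v * (flux v / rho v * rho r)); first by lra.
  by rewrite F3; field; rewrite x0 m0 t0.
apply/colP; apply: ord4P; rewrite !mxE /=.
- by rewrite divfK.
- exact: F2.
- exact: F3.
- exact: F4.
Qed.

(** * Differentials of the wave speeds *)

Lemma is_diff_temperature v : is_state v ->
  is_diff v temperature (fun h => temperature v * (rho h / rho v + eta h)).
Proof.
move=> v0; have x0 : rho v != 0 by rewrite gt_eqF.
have dexp := is_diff_chain (is_diff_coord v o3 ord0) (is_derive_expR (eta v)).
apply: is_diff_eq (is_diff_prod (is_diff_coord v o1 ord0) dexp) _.
apply/funext => h; rewrite /temperature /gas_theta.
rewrite -[v o1 ord0]/(rho v) -[h o1 ord0]/(rho h).
by rewrite -[h o3 ord0]/(eta h) -[v o3 ord0]/(eta v); field.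
Qed.

Lemma is_diff_kv2 v : is_state v ->
  is_diff v kv2 (fun h => - 2 * kv2 v * (rho h / rho v)).
Proof.
move=> v0; have x0 : rho v != 0 by rewrite gt_eqF.
have dsq (x : R) : x != 0 ->
    is_derive x 1 (fun x : R => (kappa / x) ^+ 2) (- 2 * (kappa / x) ^+ 2 / x).
  move=> xn0.
  have := is_deriveX 2 (is_deriveZ kappa (is_deriveV xn0 (is_derive_id x 1))).
  move=> /is_derive_eq; apply; rewrite /GRing.scale /=.
  by rewrite -[kappa *: _]/(kappa * _); field.
apply: is_diff_eq (is_diff_chain (is_diff_coord v o1 ord0) (dsq _ x0)) _.
by apply/funext => h; rewrite /kv2 -[h o1 ord0]/(rho h); field.
Qed.

(** Logarithmic differentiation of T (1 + w): 2 d mu / mu = dT/T + dw/(1 + w),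
    where dw = w^2/(w^2 + 1) dm and dm = - 2 m d rho / rho. *)
Lemma is_diff_wave_speed s v : is_state v -> s ^+ 2 = 1 ->
  let w := branch s (kv2 v) in
  is_diff v (wave_speed s) (fun h => wave_speed s v / 2 * (rho h / rho v + eta h
     - 2 * kv2 v * w ^+ 2 / ((w ^+ 2 + 1) * (1 + w)) * (rho h / rho v))).
Proof.
move=> v0 s1 w; have x0 : rho v != 0 by rewrite gt_eqF.
have t0 : temperature v != 0 by rewrite gt_eqF // temperature_gt0.
have w10 := branch_kv2_gt v0 s1; rewrite -/w in w10.
have w20 : 0 < w ^+ 2 + 1 by rewrite ltr_wpDl ?sqr_ge0.
have dw := is_diff_chain (is_diff_kv2 v0) (branch_derive (kv2 v) s1).
have dw1 := is_diff_sum (is_diff_cst (1 : R) v) dw.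
have dtw := is_diff_prod (is_diff_temperature v0) dw1.
have tw0 : 0 < temperature v * (1 + branch s (kv2 v)).
  by rewrite mulr_gt0 // temperature_gt0.
apply: is_diff_eq (is_diff_chain dtw (is_derive1_sqrt tw0)) _.
have mu0 := wave_speed_gt0 v0 s1; have mu2 := sqr_wave_speed v0 s1.
apply/funext => h; rewrite -/(wave_speed s v) -/w in mu2 *.
rewrite /cst /= add0r.
have tE : temperature v = wave_speed s v ^+ 2 / (1 + w).
  by rewrite mu2 mulfK // gt_eqF.
by rewrite tE; field; rewrite x0 !gt_eqF.
Qed.

(** The quartic factors as (mu^2 - fast^2) (mu^2 - slow^2), where fast and slow
    are the two wave speeds. *)
Lemma speed_formula_characteristic : characteristic_speeds A speed.
Proof.
move=> v v0.
have lt := wave_speed_lt v0.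
have pos : 0 < wave_speed (-1) v by rewrite wave_speed_gt0 // sqrrN expr1n.
split.
  by apply: ord4P; apply: ord4P => //= _; rewrite !speed_formula_gas //=; lra.
move=> a; rewrite eigenvalue_quartic // characteristic_quarticE //; split.
- move/eqP; rewrite !mulf_eq0 => /orP[/orP[]|/orP[]] /eqP aE.
  + by exists o4; rewrite speed_formula_gas //=; lra.
  + by exists o1; rewrite speed_formula_gas //=; lra.
  + by exists o3; rewrite speed_formula_gas //=; lra.
  + by exists o2; rewrite speed_formula_gas //=; lra.
- case; apply: ord4P; rewrite speed_formula_gas //= => ->; ring.
Qed.

Lemma characteristic_speeds_unique lam v i : characteristic_speeds A lam ->
  is_state v -> lam i v = speed i v.
Proof.
move=> lamP v0; have [incl spl] := lamP v v0.
have [incs sps] := speed_formula_characteristic v0.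
apply: (@increasing_enum_unique _ _ _ (lam^~ v) (speed^~ v)) => // a.
by rewrite -spl sps.
Qed.

Lemma near_is_state v : is_state v -> \forall w \near v, is_state w.
Proof.
move=> v0; have c : {for v, continuous (@rho R)}.
  exact/differentiable_continuous/differentiable_coord.
exact: (cvgr_gt _ c).
Qed.

Lemma is_diff_vel v : is_diff v (@vel R) (@vel R).
Proof. exact: is_diff_coord. Qed.

Lemma differentiable_speed lam v i : characteristic_speeds A lam ->
  is_state v -> differentiable (lam i) v.
Proof.
move=> lamP v0.
have s1 : (1 : R) ^+ 2 = 1 by rewrite expr1n.
have sN : (-1 : R) ^+ 2 = 1 by rewrite sqrrN.
have dN := is_diff_wave_speed v0 sN; have d1 := is_diff_wave_speed v0 s1.
have near_speed g dg : (forall w, is_state w -> speed i w = g w) ->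
    is_diff v g dg -> differentiable (lam i) v.
  move=> gE gd; suff : is_diff v (lam i) dg by case.
  apply: is_diff_near_eq gd; apply: filterS (near_is_state v0) => w w0.
  by rewrite (characteristic_speeds_unique _ lamP w0) gE.
move: i near_speed; apply: ord4P => near_speed.
- apply: near_speed (is_diff_diff (is_diff_vel v) d1) => w w0.
  by rewrite speed_formula_gas.
- apply: near_speed (is_diff_diff (is_diff_vel v) dN) => w w0.
  by rewrite speed_formula_gas.
- apply: near_speed (is_diff_sum (is_diff_vel v) dN) => w w0.
  by rewrite speed_formula_gas.
- apply: near_speed (is_diff_sum (is_diff_vel v) d1) => w w0.
  by rewrite speed_formula_gas.
Qed.

(** Up to its scale, r has components (rho, mu, w - 1, ...); insert them in
    [is_diff_wave_speed] and eliminate m by m = w - 1/w. The derivative is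
    mu (1 + (w - 2 w (w - 1)/(w^2 + 1)) / 2), which has the stated form. *)
Lemma grad_dot_forward s (f : 'cV[R]_4 -> R) (r : 'cV[R]_4 -> 'cV[R]_4) v :
  is_state v -> s ^+ 2 = 1 ->
  (forall w, is_state w -> f w = vel w + wave_speed s w) ->
  A v *m r v = f v *: r v ->
  let w := branch s (kv2 v) in
  grad_dot f r v = rho (r v) / rho v *
    (wave_speed s v * nonlinearity_cubic w / (2 * (w ^+ 2 + 1))).
Proof.
move=> v0 s1 fE rP w.
have near_fE : \forall u \near v, f u = vel u + wave_speed s u.
  by apply: filterS (near_is_state v0) => u u0; rewrite fE.
have fd := is_diff_near_eq near_fE
  (is_diff_sum (is_diff_vel v) (is_diff_wave_speed v0 s1)).
rewrite (grad_dotE _ fd); rewrite fE // in rP.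
have x0 : rho v != 0 by rewrite gt_eqF.
have t0 : temperature v != 0 by rewrite gt_eqF // temperature_gt0.
have rE := gas_eigenvector_unique v0 rP.
set q := rho (r v) / rho v in rE *.
have -> : vel (r v) = q * wave_speed s v by rewrite rE /vel !mxE.
have -> : eta (r v) = q * (w - 1).
  rewrite rE /Defs.eta !mxE /= sqr_wave_speed //; congr (_ * _).
  by rewrite -/w mulrAC mulfV // ; ring.
rewrite -/w -/q.
have wq := branch_quadratic (kv2 v) s1; rewrite -/w in wq.
have w0 := quadratic_neq0 wq; rewrite (quadratic_solve wq) /nonlinearity_cubic.
have w10 := branch_kv2_gt v0 s1; rewrite -/w in w10.
have w20 : 0 < w ^+ 2 + 1 by rewrite ltr_wpDl ?sqr_ge0.
by field; rewrite w0 !gt_eqF.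
Qed.

Lemma rho_eigenvector_neq0 v a (r : 'cV[R]_4) : is_state v ->
  A v *m r = a *: r -> r != 0 -> rho r != 0.
Proof.
move=> v0; rewrite -[a](subrK (vel v)) addrC => /(gas_eigenvector_unique v0) rE.
by apply: contraNneq => r0; rewrite rE r0 mul0r scale0r.
Qed.

(** Here m = (kappa / rho)^2 and m - c^2 = (kappa / rho - c) (kappa / rho + c),
    so [nonlinearity_cubic_sign] gives the sign of the cubic in terms of
    kappa / rho - c. *)
Lemma slow_field_sign (f : 'cV[R]_4 -> R) (r : 'cV[R]_4 -> 'cV[R]_4) v :
  is_state v -> (forall w, is_state w -> f w = vel w + wave_speed (-1) w) ->
  A v *m r v = f v *: r v ->
  exists2 k, 0 < k & grad_dot f r v =
    rho (r v) / rho v * (k * (kappa / rho v - critical_value R)).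
Proof.
move=> v0 fE rP; have s1 : (-1 : R) ^+ 2 = 1 by rewrite sqrrN expr1n.
rewrite (grad_dot_forward v0 s1 fE rP).
have := branchN1_lt0 (kv2 v); have wq := branch_quadratic (kv2 v) s1.
move: (branch _ _) wq => w wq wneg.
have [k k0 ->] := nonlinearity_cubic_sign wneg.
rewrite -(quadratic_solve wq) /kv2 subr_sqr.
have m0 : 0 < kappa / rho v by rewrite divr_gt0.
have c0 := critical_value_gt0 R.
have w20 : 0 < w ^+ 2 + 1 by rewrite ltr_wpDl ?sqr_ge0.
exists (wave_speed (-1) v * k * (kappa / rho v + critical_value R)
  / (2 * (w ^+ 2 + 1))).
  by rewrite divr_gt0 ?mulr_gt0 ?(wave_speed_gt0 v0 s1) ?(addr_gt0 m0 c0).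
congr (_ * _); move: (kappa / rho v) (wave_speed _ _) => a b.
by field; rewrite gt_eqF.
Qed.

End Gas.

(** * Nonlinearity of the third and fourth fields *)

Theorem mainTheorem4 (R : realType) (kappa : R) (hkappa : 0 < kappa) :
  let A := quasilinear_matrix kappa (@gas_p R) (@gas_theta R) in
  let c := critical_value R in
  characteristic_speeds A (speed_formula kappa (@gas_p R) (@gas_theta R)) /\
  (10399 / 10000 <= c /\ c < 10400 / 10000) /\
  forall lam : 'I_4 -> 'cV[R]_4 -> R, characteristic_speeds A lam ->
    (forall (i : 'I_4) (v : 'cV[R]_4), is_state v -> differentiable (lam i) v) /\
    (exists r : 'I_4 -> 'cV[R]_4 -> 'cV[R]_4, right_eigenvectors A lam r /\
       forall v, is_state v -> rho (r o3 v) = rho v) /\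
    forall r : 'I_4 -> 'cV[R]_4 -> 'cV[R]_4, right_eigenvectors A lam r ->
      (forall v, is_state v -> grad_dot (lam o4) (r o4) v != 0) /\
      (forall v, is_state v ->
         (grad_dot (lam o3) (r o3) v = 0 <-> kappa * (rho v)^-1 = c)) /\
      ((forall v, is_state v -> rho (r o3 v) = rho v) ->
       forall v w, is_state v -> is_state w ->
         kappa * (rho v)^-1 < c -> c < kappa * (rho w)^-1 ->
         grad_dot (lam o3) (r o3) v * grad_dot (lam o3) (r o3) w < 0) /\
      genuinely_nonlinear (lam o4) (r o4) /\
      ~ genuinely_nonlinear (lam o3) (r o3) /\
      ~ linearly_degenerate (lam o3) (r o3).
Proof.
move=> A c; have c0 : 0 < c := critical_value_gt0 R.
split; first exact: speed_formula_characteristic.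
split; first exact: critical_value_bounds.
move=> lam lamP; split.
  by move=> i v; exact: (differentiable_speed hkappa).
split.
  exists (fun i v => gas_eigenvector kappa v (lam i v - vel v)).
  split=> [v v0 i|v v0]; last by rewrite /gas_eigenvector rho_state_of.
  split.
    apply/eqP => /(congr1 (@rho R)).
    rewrite /gas_eigenvector rho_state_of /rho mxE.
    by apply/eqP; rewrite gt_eqF.
  rewrite gas_eigenvectorP //; first by rewrite addrC subrK.
  apply/eigenvalue_quartic => //; apply/(proj2 (lamP v v0)).
  by exists i.
move=> r rP.
have lam3 v : is_state v -> lam o3 v = vel v + wave_speed kappa (-1) v.
  move=> v0; rewrite (characteristic_speeds_unique hkappa _ lamP v0).
  by rewrite speed_formula_gas.
have lam4 v : is_state v -> lam o4 v = vel v + wave_speed kappa 1 v.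
  move=> v0; rewrite (characteristic_speeds_unique hkappa _ lamP v0).
  by rewrite speed_formula_gas.
have grad3 v (v0 : is_state v) :=
  slow_field_sign hkappa v0 lam3 (proj2 (rP v v0 o3)).
have rho_r v i (v0 : is_state v) : rho (r i v) != 0.
  by have [rn0 rE] := rP v v0 i; exact: (rho_eigenvector_neq0 hkappa v0 rE rn0).
have gnl4 v : is_state v -> grad_dot (lam o4) (r o4) v != 0.
  move=> v0; have s1 : (1 : R) ^+ 2 = 1 by rewrite expr1n.
  rewrite (grad_dot_forward hkappa v0 s1 lam4 (proj2 (rP v v0 o4))).
  have w1 := branch1_gt1 (kv2_gt0 hkappa v0).
  rewrite mulf_neq0 ?mulf_neq0 ?invr_neq0 ?rho_r // ?gt_eqF //.
  - by rewrite wave_speed_gt0.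
  - by rewrite /nonlinearity_cubic; nra.
  - nra.
have zero3 v : is_state v ->
    (grad_dot (lam o3) (r o3) v = 0 <-> kappa * (rho v)^-1 = c).
  move=> v0; have [k k0 ->] := grad3 v v0; split=> [/eqP|->].
    rewrite !mulf_eq0 invr_eq0 (negPf (rho_r v o3 v0)).
    by rewrite (gt_eqF (v0 : 0 < rho v)) (gt_eqF k0) /= subr_eq0 => /eqP.
  by rewrite subrr !mulr0.
(* a state at which kappa / rho takes the prescribed value a *)
pose at_kv (a : R) : 'cV[R]_4 := state_of (kappa / a) 0 0 0.
have at_kv_state a : 0 < a -> is_state (at_kv a).
  by move=> a0; rewrite /is_state rho_state_of divr_gt0.
have at_kvE a : 0 < a -> kappa * (rho (at_kv a))^-1 = a.
  by move=> a0; rewrite rho_state_of invf_div mulrC divfK // gt_eqF.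
split=> //; split=> //; split.
  move=> rho_norm v w v0 w0 vc cw.
  have [k k0 ->] := grad3 v v0; have [l l0 ->] := grad3 w w0.
  rewrite !rho_norm // !divff ?gt_eqF // !mul1r.
  by rewrite nmulr_rlt0 ?pmulr_rgt0 ?pmulr_rlt0 ?subr_gt0 ?subr_lt0.
split=> //; split.
- move=> /(_ _ (at_kv_state c c0)) /eqP; apply.
  exact/(zero3 _ (at_kv_state c c0))/at_kvE.
(* kappa / rho = 2 c is a non-critical value *)
- have c20 : 0 < 2 * c by rewrite mulr_gt0.
  move=> /(_ _ (at_kv_state _ c20)) /(zero3 _ (at_kv_state _ c20)).
  by rewrite at_kvE //; lra.
Qed.
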